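(* Let $V_1,V_2,V_3$ be finite-dimensional complex vector spaces and let $S \in V_1 \otimes V_2 \otimes V_3$ be any tensor. Suppose that the unit tensor $\langle r \rangle$ partially degenerates to $S$ via degeneration maps $A_1, A_2(\epsilon), A_3(\epsilon)$, where the constant map $A_1:\mathbb{C}^r\to V_1$ is of full rank $r$. Then $\langle r \rangle$ restricts to $S$.
   Context: The unit tensor is $\langle r \rangle = \sum_{i=1}^r e_i\otimes e_i\otimes e_i\in\mathbb{C}^r\otimes\mathbb{C}^r\otimes\mathbb{C}^r$. For tensors $T \in U_1 \otimes U_2 \otimes U_3$ and $S \in V_1\otimes V_2\otimes V_3$ (finite-dimensional complex vector spaces): - $T$ restricts to $S$ if there are linear maps $A_i: U_i\to V_i$ ($i=1,2,3$) with $S=(A_1\otimes A_2\otimes A_3)T$. - $T$ partially degenerates to $S$ via the maps $A_1,A_2(\epsilon),A_3(\epsilon)$ if $A_1:U_1\to V_1$ is a (constant) linear map, $A_2(\epsilon):U_2\to V_2$ and $A_3(\epsilon):U_3\to V_3$ are linear maps with entries in $\mathbb{C}[\epsilon]$, and there are natural numbers $d,e\ge 0$ and tensors $S_1,\dots,S_e \in V_1\otimes V_2\otimes V_3$ such that $(A_1\otimes A_2(\epsilon)\otimes A_3(\epsilon))T=\epsilon^d S+\epsilon^{d+1}S_1+\dots+\epsilon^{d+e}S_e$. *)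

(* Defs.v *)
From HB Require Import structures.
From mathcomp Require Import all_boot all_order all_algebra.
From mathcomp Require Import reals complex.

Set Implicit Arguments.
Unset Strict Implicit.
Unset Printing Implicit Defensive.

Import GRing.Theory Num.Theory.
Local Open Scope ring_scope.

Definition dual (K : fieldType) (V : vectType K) := 'Hom(V, K^o).

(* V1 (x) V2 (x) V3, realised as the trilinear forms on V1^* x V2^* x V3^* (in
   curried form). The spaces are finite-dimensional, so this is canonically
   isomorphic to the tensor product, with v1 (x) v2 (x) v3 corresponding to
   (f1, f2, f3) |-> f1 v1 * f2 v2 * f3 v3. *)
Definition tensor (K : fieldType) (V1 V2 V3 : vectType K) :=
  'Hom(dual V1, 'Hom(dual V2, dual (dual V3))).

Definition ptensor (K : fieldType) (V1 V2 V3 : vectType K)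
    (v1 : V1) (v2 : V2) (v3 : V3) : tensor V1 V2 V3 :=
  linfun (fun f1 : dual V1 => linfun (fun f2 : dual V2 =>
    linfun (fun f3 : dual V3 => (f1 v1 * f2 v2 * f3 v3 : K^o)))).

(* The linear map A1 (x) A2 (x) A3. *)
Definition tensor_map (K : fieldType) (U1 U2 U3 V1 V2 V3 : vectType K)
    (A1 : 'Hom(U1, V1)) (A2 : 'Hom(U2, V2)) (A3 : 'Hom(U3, V3))
    (T : tensor U1 U2 U3) : tensor V1 V2 V3 :=
  linfun (fun f1 : dual V1 => linfun (fun f2 : dual V2 =>
    linfun (fun f3 : dual V3 =>
      T (f1 \o A1)%VF (f2 \o A2)%VF (f3 \o A3)%VF))).

(* linfun is only meaningful on linear functions; the next lemmas check that it
   is used on such functions above. *)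
Lemma trilinfunE (K : fieldType) (W1 W2 W3 : vectType K)
    (F : W1 -> W2 -> W3 -> K^o) :
  (forall f2 f3, linear (fun f1 => F f1 f2 f3)) ->
  (forall f1 f3, linear (fun f2 => F f1 f2 f3)) ->
  (forall f1 f2, linear (F f1 f2)) ->
  forall f1 f2 f3,
    linfun (fun f1 => linfun (fun f2 => linfun (F f1 f2))) f1 f2 f3 = F f1 f2 f3.
Proof.
move=> lin1 lin2 lin3.
have E3 f1 f2 f3 : linfun (F f1 f2) f3 = F f1 f2 f3.
  pose L := GRing.isLinear.Build K W3 K^o *:%R (F f1 f2) (lin3 f1 f2).
  pose F3 : {linear W3 -> K^o} := HB.pack (F f1 f2) L.
  exact: (lfunE F3).
have E2 f1 f2 : linfun (fun f2 => linfun (F f1 f2)) f2 = linfun (F f1 f2).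
  have lin : linear (fun f2 => linfun (F f1 f2)).
    by move=> a u v; apply/lfunP => f3; rewrite add_lfunE scale_lfunE !E3 lin2.
  pose L := GRing.isLinear.Build K W2 _ *:%R (fun f2 => linfun (F f1 f2)) lin.
  pose F2 : {linear W2 -> 'Hom(W3, K^o)} :=
    HB.pack (fun f2 => linfun (F f1 f2)) L.
  exact: (lfunE F2).
move=> f1 f2 f3; rewrite -E3 -E2; congr (fun_of_lfun (fun_of_lfun _ _) _).
have lin : linear (fun f1 => linfun (fun f2 => linfun (F f1 f2))).
  move=> a u v; apply/lfunP => g2; apply/lfunP => g3.
  by rewrite !(add_lfunE, scale_lfunE, E2, E3) lin1.
pose L := GRing.isLinear.Build K W1 _ *:%R
  (fun f1 => linfun (fun f2 => linfun (F f1 f2))) lin.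
pose F1 : {linear W1 -> 'Hom(W2, 'Hom(W3, K^o))} :=
  HB.pack (fun f1 => linfun (fun f2 => linfun (F f1 f2))) L.
exact: (lfunE F1).
Qed.

Lemma ptensorE (K : fieldType) (V1 V2 V3 : vectType K)
    (v1 : V1) (v2 : V2) (v3 : V3) f1 f2 f3 :
  ptensor v1 v2 v3 f1 f2 f3 = f1 v1 * f2 v2 * f3 v3.
Proof.
rewrite /ptensor trilinfunE //.
- move=> g2 g3 a u v; rewrite add_lfunE scale_lfunE !mulrDl.
  by rewrite /GRing.scale /= !mulrA.
- move=> g1 g3 a u v; rewrite add_lfunE scale_lfunE mulrDr mulrDl.
  by rewrite /GRing.scale /= !mulrA [_ * a]mulrC.
- move=> g1 g2 a u v; rewrite add_lfunE scale_lfunE mulrDr.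
  by rewrite /GRing.scale /= [_ * (a * _)]mulrCA.
Qed.

Lemma tensor_mapE (K : fieldType) (U1 U2 U3 V1 V2 V3 : vectType K)
    (A1 : 'Hom(U1, V1)) (A2 : 'Hom(U2, V2)) (A3 : 'Hom(U3, V3))
    (T : tensor U1 U2 U3) f1 f2 f3 :
  tensor_map A1 A2 A3 T f1 f2 f3 =
  T (f1 \o A1)%VF (f2 \o A2)%VF (f3 \o A3)%VF.
Proof.
rewrite /tensor_map trilinfunE //.
- by move=> g2 g3 a u v; rewrite comp_lfunDl -comp_lfunZl linearP !(add_lfunE, scale_lfunE).
- by move=> g1 g3 a u v; rewrite comp_lfunDl -comp_lfunZl linearP !(add_lfunE, scale_lfunE).
- by move=> g1 g2 a u v; rewrite comp_lfunDl -comp_lfunZl linearP.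
Qed.

Lemma tensor_map_ptensor (K : fieldType) (U1 U2 U3 V1 V2 V3 : vectType K)
    (A1 : 'Hom(U1, V1)) (A2 : 'Hom(U2, V2)) (A3 : 'Hom(U3, V3))
    (u1 : U1) (u2 : U2) (u3 : U3) :
  tensor_map A1 A2 A3 (ptensor u1 u2 u3) = ptensor (A1 u1) (A2 u2) (A3 u3).
Proof.
apply/lfunP => f1; apply/lfunP => f2; apply/lfunP => f3.
by rewrite tensor_mapE !ptensorE !comp_lfunE.
Qed.

Definition unit_tensor (K : fieldType) (r : nat) :
    tensor 'rV[K]_r 'rV[K]_r 'rV[K]_r :=
  \sum_(i < r) ptensor (delta_mx 0 i) (delta_mx 0 i) (delta_mx 0 i).

Definition restricts (K : fieldType) (U1 U2 U3 V1 V2 V3 : vectType K)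
    (T : tensor U1 U2 U3) (S : tensor V1 V2 V3) : Prop :=
  exists (A1 : 'Hom(U1, V1)) (A2 : 'Hom(U2, V2)) (A3 : 'Hom(U3, V3)),
    S = tensor_map A1 A2 A3 T.

(* A linear map A(eps) with entries in K[eps] is given by its values at all
   eps in K. This loses nothing: a numFieldType is infinite, so polynomials
   over K, and the coefficients of vector-valued ones, are determined by their
   values. The entries of A(eps) in all bases are the f (A eps u). *)
Definition poly_entries (K : numFieldType) (U V : vectType K)
    (A : K -> 'Hom(U, V)) : Prop :=
  forall (u : U) (f : dual V),
    exists p : {poly K}, forall eps : K, f (A eps u) = p.[eps].

Definition partially_degenerates_via (K : numFieldType)
    (U1 U2 U3 V1 V2 V3 : vectType K)
    (T : tensor U1 U2 U3) (S : tensor V1 V2 V3)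
    (A1 : 'Hom(U1, V1)) (A2 : K -> 'Hom(U2, V2)) (A3 : K -> 'Hom(U3, V3)) :
    Prop :=
  [/\ poly_entries A2, poly_entries A3 &
    exists (d e : nat) (S_ : 'I_e -> tensor V1 V2 V3), forall eps : K,
      tensor_map A1 (A2 eps) (A3 eps) T =
      eps ^+ d *: S + \sum_(j < e) eps ^+ (d + j.+1) *: S_ j].

(* Main.v *)
From HB Require Import structures.
Require Import Defs.
From mathcomp Require Import all_boot all_order all_algebra.
From mathcomp Require Import reals complex.
From mathcomp Require Import ring.

Set Implicit Arguments.
Unset Strict Implicit.

Import GRing.Theory Num.Theory.
Local Open Scope ring_scope.

(** Write a_i for A1 e_i, so that the degeneration reads
      sum_i a_i (x) b_i(eps) (x) c_i(eps) = eps^d S + O(eps^(d+1)).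
    Since A1 is injective, the a_i have a dual family phi_i in V1^*, and
    contracting the first factor with phi_i isolates one summand:
      b_i(eps) (x) c_i(eps) = eps^d S(phi_i) + O(eps^(d+1)).
    The matrices on the left have rank at most one, so their 2 x 2 minors
    vanish; the trailing coefficient of such a minor is the minor of S(phi_i),
    hence S(phi_i) = b_i (x) c_i for constant vectors b_i and c_i
    ([degeneration_slice_minors], [rank_one_of_minors]).
    On the other hand A1 is constant, so the first factor of S stays in the
    image of A1 ([degeneration_fixed_left]), which gives
    S = sum_i a_i (x) S(phi_i) = sum_i a_i (x) b_i (x) c_i.
    Hence A1, e_i |-> b_i and e_i |-> c_i exhibit the restriction. *)

Lemma lfun_of_basis_images (K : fieldType) (V : vectType K) (r : nat)
    (b : 'I_r -> V) :
  exists A : 'Hom('rV[K]_r, V), forall i, A (delta_mx 0 i) = b i.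
Proof.
pose F (u : 'rV[K]_r) := \sum_i u 0 i *: b i.
have lin : linear F.
  move=> a u v; rewrite /F scaler_sumr -big_split; apply: eq_bigr => i _ /=.
  by rewrite !mxE scalerDl scalerA.
pose L := GRing.isLinear.Build K 'rV[K]_r V *:%R F lin.
pose A : {linear 'rV[K]_r -> V} := HB.pack F L.
exists (linfun A) => i; rewrite (lfunE A) /= /F (bigD1 i) //= big1 => [|j ji].
  by rewrite mxE !eqxx scale1r addr0.
by rewrite mxE (negPf ji) andbF scale0r.
Qed.

(** Finite-dimensional spaces are reflexive; the vector is read off from the
    values of [phi] on the coordinate functionals of a basis. *)
Lemma bidual_eval (K : fieldType) (V : vectType K) (phi : dual (dual V)) :
  exists v : V, forall f : dual V, phi f = f v.
Proof.
pose e := vbasis (@fullv K V).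
pose x (i : 'I_(\dim (@fullv K V))) : dual V := linfun (coord e i : V -> K^o).
exists (\sum_i phi (x i) *: e`_i) => f.
have fE : f = \sum_(i < \dim (@fullv K V)) f e`_i *: x i.
  apply/lfunP => v; rewrite {1}(coord_vbasis (memvf v)) linear_sum sum_lfunE.
  apply: eq_bigr => i _.
  by rewrite linearZ scale_lfunE lfunE /= /GRing.scale /= mulrC.
rewrite {1}fE !linear_sum; apply: eq_bigr => i _.
by rewrite !linearZ; exact: mulrC.
Qed.

(** A nonzero entry B f0 g0 serves as pivot: the minors through it say that
    B f g = B f g0 * B f0 g / B f0 g0. *)
Lemma rank_one_of_minors (K : fieldType) (V W : vectType K)
    (B : 'Hom(dual V, dual (dual W))) :
  (forall f f' g g', B f g * B f' g' = B f g' * B f' g) ->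
  exists (v : V) (w : W), forall f g, B f g = f v * g w.
Proof.
move=> minors.
have [->|/lfunPn[f0]] := eqVneq B 0.
  by exists 0, 0 => f g; rewrite !lfunE /= linear0 mul0r.
rewrite zero_lfunE => /lfunPn[g0]; rewrite zero_lfunE => pivot.
have lin : linear (fun f => B f g0 : K^o).
  by move=> a f f'; rewrite linearP add_lfunE scale_lfunE.
pose L := GRing.isLinear.Build K (dual V) K^o *:%R (fun f => B f g0) lin.
pose col : {linear dual V -> K^o} := HB.pack (fun f => B f g0) L.
have [v vE] := bidual_eval (linfun col).
have [w wE] := bidual_eval (B f0).
exists ((B f0 g0)^-1 *: v), w => f g.
rewrite linearZ /= -vE -wE (lfunE col) /= /GRing.scale /= -mulrA -minors.
by rewrite mulrC mulfK.
Qed.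

Lemma unit_tensor_mapE (K : fieldType) (r : nat) (V1 V2 V3 : vectType K)
    (A1 : 'Hom('rV[K]_r, V1)) (A2 : 'Hom('rV[K]_r, V2))
    (A3 : 'Hom('rV[K]_r, V3)) f1 f2 f3 :
  tensor_map A1 A2 A3 (unit_tensor K r) f1 f2 f3 =
  \sum_(i < r) f1 (A1 (delta_mx 0 i)) * f2 (A2 (delta_mx 0 i))
               * f3 (A3 (delta_mx 0 i)).
Proof.
rewrite tensor_mapE /unit_tensor !sum_lfunE; apply: eq_bigr => i _.
by rewrite ptensorE !comp_lfunE.
Qed.

(** A polynomial is determined by its values because [K] is infinite; this is
    what makes the comparison of trailing coefficients legitimate. *)
Lemma trailing_coef_eq0 (K : numFieldType) (p : {poly K}) (n : nat) :
  (forall eps : K, eps ^+ n * p.[eps] = 0) -> p.[0] = 0.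
Proof.
move=> zero; suff -> : p = 0 by rewrite horner0.
apply/eqP; apply: contraT => p0.
have q0 : 'X^n * p != 0 by rewrite mulf_neq0 // -size_poly_eq0 size_polyXn.
pose s := [seq i%:R : K | i <- iota 0 (size ('X^n * p))].
have uniq_s : uniq s.
  by rewrite map_inj_uniq ?iota_uniq // => i j /eqP; rewrite eqr_nat => /eqP.
have roots_s : all (root ('X^n * p)) s.
  by apply/allP => x _; rewrite rootE hornerM hornerXn zero.
by have := max_poly_roots q0 roots_s uniq_s; rewrite size_map size_iota ltnn.
Qed.

(** The scalar form of the degeneration: every entry of the family is
    eps^d p(eps), with p(0) the corresponding entry of [S]. *)
Lemma degeneration_poly (K : numFieldType) (V1 V2 V3 : vectType K)
    (S : tensor V1 V2 V3) (d e : nat) (S_ : 'I_e -> tensor V1 V2 V3)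
    (T : K -> tensor V1 V2 V3) f1 f2 f3 :
  (forall eps, T eps = eps ^+ d *: S + \sum_(j < e) eps ^+ (d + j.+1) *: S_ j) ->
  exists p : {poly K}, p.[0] = S f1 f2 f3 /\
    forall eps, T eps f1 f2 f3 = eps ^+ d * p.[eps].
Proof.
move=> TE.
pose p := (S f1 f2 f3 : K)%:P + \sum_(j < e) (S_ j f1 f2 f3 : K) *: 'X^(j.+1).
have pE eps : p.[eps] = S f1 f2 f3 + \sum_(j < e) S_ j f1 f2 f3 * eps ^+ j.+1.
  rewrite /p hornerD hornerC horner_sum; congr (_ + _).
  by apply: eq_bigr => j _; rewrite hornerZ hornerXn.
exists p; split=> [|eps].
  by rewrite pE big1 ?addr0 // => j _; rewrite expr0n mulr0.
rewrite TE pE mulrDr mulr_sumr !add_lfunE !scale_lfunE !sum_lfunE.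
congr (_ + _); apply: eq_bigr => j _.
by rewrite !scale_lfunE exprD /GRing.scale /= -mulrA [_ * eps ^+ _]mulrC.
Qed.

(** Invariance of the first factor under [C] says that S - (C (x) 1 (x) 1) S
    vanishes. It passes from the family to its trailing coefficient because [C],
    like [A1], does not depend on eps; with [C] a projection onto the image of
    [A1], it puts the first factor of [S] in that image. *)
Lemma degeneration_fixed_left (K : numFieldType)
    (U1 U2 U3 V1 V2 V3 : vectType K)
    (T : tensor U1 U2 U3) (S : tensor V1 V2 V3)
    (A1 : 'Hom(U1, V1)) (A2 : K -> 'Hom(U2, V2)) (A3 : K -> 'Hom(U3, V3))
    (C : 'Hom(V1, V1)) :
  partially_degenerates_via T S A1 A2 A3 -> (C \o A1)%VF = A1 ->
  forall f1 : dual V1, S (f1 \o C)%VF = S f1.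
Proof.
move=> [_ _ [d [e [S_ TE]]]] CA f1; apply/lfunP => f2; apply/lfunP => f3.
apply/eqP; rewrite -subr_eq0; apply/eqP.
have -> : S (f1 \o C)%VF f2 f3 - S f1 f2 f3 = S (f1 \o C - f1)%VF f2 f3.
  by rewrite linearB !add_lfunE !opp_lfunE.
have [p [<- pE]] := degeneration_poly (f1 \o C - f1)%VF f2 f3 TE.
apply: (@trailing_coef_eq0 _ _ d) => eps; rewrite -pE tensor_mapE.
by rewrite comp_lfunDl comp_lfunNl -comp_lfunA CA subrr !(linear0, zero_lfunE).
Qed.

(** Since [phi] kills all a_j but a_i, the slice of the family along [phi] is
    phi(a_i) b_i(eps) (x) c_i(eps), whose minors vanish. Each of these minors is
    also eps^(2d) times a polynomial whose constant term is the corresponding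
    minor of [S phi]. *)
Lemma degeneration_slice_minors (K : numFieldType) (r : nat)
    (V1 V2 V3 : vectType K) (S : tensor V1 V2 V3)
    (A1 : 'Hom('rV[K]_r, V1)) (A2 : K -> 'Hom('rV[K]_r, V2))
    (A3 : K -> 'Hom('rV[K]_r, V3)) (phi : dual V1) (i : 'I_r) :
  partially_degenerates_via (unit_tensor K r) S A1 A2 A3 ->
  (forall j, j != i -> phi (A1 (delta_mx 0 j)) = 0) ->
  forall f f' g g', S phi f g * S phi f' g' = S phi f g' * S phi f' g.
Proof.
move=> [_ _ [d [e [S_ TE]]]] supp f f' g g'.
have slice eps h k : tensor_map A1 (A2 eps) (A3 eps) (unit_tensor K r) phi h k =
    phi (A1 (delta_mx 0 i)) * h (A2 eps (delta_mx 0 i)) * k (A3 eps (delta_mx 0 i)).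
  rewrite unit_tensor_mapE (bigD1 i) //= big1 ?addr0 // => j ji.
  by rewrite supp // !mul0r.
have poly h k : exists p : {poly K}, p.[0] = S phi h k /\
    forall eps, eps ^+ d * p.[eps] = phi (A1 (delta_mx 0 i)) *
      h (A2 eps (delta_mx 0 i)) * k (A3 eps (delta_mx 0 i)).
  have [p [p0 pE]] := degeneration_poly phi h k TE.
  by exists p; split=> // eps; rewrite -pE slice.
have [p [p0 pE]] := poly f g; have [p' [p'0 p'E]] := poly f' g'.
have [q [q0 qE]] := poly f g'; have [q' [q'0 q'E]] := poly f' g.
apply/eqP; rewrite -subr_eq0 -p0 -p'0 -q0 -q'0 -!hornerM -hornerN -hornerD.
apply/eqP; apply: (@trailing_coef_eq0 _ _ (d + d)) => eps.
rewrite hornerD hornerN !hornerM mulrBr exprD mulrACA [X in _ - X]mulrACA.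
by rewrite pE p'E qE q'E; ring.
Qed.

Lemma unit_tensor_restricts_of_partial_degeneration (K : numFieldType) (r : nat)
    (V1 V2 V3 : vectType K) (S : tensor V1 V2 V3)
    (A1 : 'Hom('rV[K]_r, V1)) (A2 : K -> 'Hom('rV[K]_r, V2))
    (A3 : K -> 'Hom('rV[K]_r, V3)) :
  partially_degenerates_via (unit_tensor K r) S A1 A2 A3 ->
  \dim (limg A1) = r ->
  restricts (unit_tensor K r) S.
Proof.
move=> degen rkA1.
have kerA1 : lker A1 == 0%VS.
  have := limg_ker_dim A1 fullv; rewrite capfv rkA1 dimvf /dim /= mul1n.
  by move/(canRL (addnK r)); rewrite subnn => /eqP; rewrite dimv_eq0.
pose a i := A1 (delta_mx 0 i).
(* The family dual to the a_i: the coordinates of a left inverse of A1. *)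
have [phi phiV] : exists phi : 'I_r -> dual V1,
    forall i v, phi i v = (A1^-1)%VF v 0 i.
  have lin i : linear (fun u : 'rV[K]_r => u 0 i : K^o).
    by move=> c u v; rewrite !mxE.
  pose L i := GRing.isLinear.Build K 'rV[K]_r K^o *:%R (fun u => u 0 i) (lin i).
  pose x i : {linear 'rV[K]_r -> K^o} :=
    HB.pack (fun u : 'rV[K]_r => u 0 i) (L i).
  exists (fun i => (linfun (x i) \o A1^-1)%VF) => i v.
  by rewrite comp_lfunE (lfunE (x i)).
have phiE i u : phi i (A1 u) = u 0 i by rewrite phiV lker0_lfunK.
have slices f1 : S f1 = \sum_i f1 (a i) *: S (phi i).
  (* The projection onto the image of A1, which is sum_i phi_i(.) a_i. *)
  pose C := (A1 \o A1^-1)%VF.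
  have CA : (C \o A1)%VF = A1.
    by rewrite -comp_lfunA lker0_compVf // comp_lfun1r.
  rewrite -(degeneration_fixed_left degen CA).
  have -> : (f1 \o C)%VF = \sum_i f1 (a i) *: phi i.
    apply/lfunP => v; rewrite sum_lfunE !comp_lfunE.
    rewrite {1}[(A1^-1)%VF v]row_sum_delta.
    rewrite !linear_sum; apply: eq_bigr => i _; rewrite !linearZ scale_lfunE phiV.
    by rewrite /GRing.scale /= mulrC.
  by rewrite linear_sum; apply: eq_bigr => i _; rewrite linearZ.
have [bc bcE] : exists bc : 'I_r -> V2 * V3,
    forall i f2 f3, S (phi i) f2 f3 = f2 (bc i).1 * f3 (bc i).2.
  apply: (@fin_all_exists _ _ (fun i bc => forall f2 f3,
    S (phi i) f2 f3 = f2 bc.1 * f3 bc.2)) => i.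
  have [|b [c bcE]] := @rank_one_of_minors _ _ _ (S (phi i)); last first.
    by exists (b, c).
  apply: (degeneration_slice_minors (i := i) degen) => j ji.
  by rewrite phiE mxE eqxx eq_sym (negPf ji).
have [B BE] := lfun_of_basis_images (fun i => (bc i).1).
have [C CE] := lfun_of_basis_images (fun i => (bc i).2).
exists A1, B, C; apply/lfunP => f1; apply/lfunP => f2; apply/lfunP => f3.
rewrite unit_tensor_mapE slices !sum_lfunE; apply: eq_bigr => i _.
by rewrite !scale_lfunE bcE BE CE /GRing.scale /= mulrA.
Qed.

Theorem proposition3p14 (R : realType) (V1 V2 V3 : vectType R[i])
    (S : tensor V1 V2 V3) (r : nat)
    (A1 : 'Hom('rV[R[i]]_r, V1))
    (A2 : R[i] -> 'Hom('rV[R[i]]_r, V2))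
    (A3 : R[i] -> 'Hom('rV[R[i]]_r, V3)) :
  partially_degenerates_via (unit_tensor R[i] r) S A1 A2 A3 ->
  \dim (limg A1) = r ->
  restricts (unit_tensor R[i] r) S.
Proof. exact: unit_tensor_restricts_of_partial_degeneration. Qed.
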